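(* Let $G$ be a finite non-abelian group, let $H$ be a subgroup of $G$ with $H \neq Z(H,G)$, and let $g \in K(H,G)$. Let $x \in G \setminus H$ be any vertex of $\Gamma_{H,G}^g$, and let $\deg(x)$ denote its degree in $\Gamma_{H,G}^g$. Say that $x$ is $H$-conjugate to $z \in G$ if there is $h \in H$ with $h^{-1}xh = z$. Then: (a) If $g = 1$, then $\deg(x) = |H| - |C_H(x)|$. (b) If $g \neq 1$ and $g^2 \neq 1$, then $\deg(x) = |H| - |C_H(x)|$ if $x$ is $H$-conjugate to exactly one of $xg$ and $xg^{-1}$, and $\deg(x) = |H| - 2|C_H(x)|$ if $x$ is $H$-conjugate to both $xg$ and $xg^{-1}$. (c) If $g \neq 1$ and $g^2 = 1$, then $\deg(x) = |H| - |C_H(x)|$ whenever $x$ is $H$-conjugate to $xg$.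
   Context: For $x,y$ in a group, $[x,y] = x^{-1}y^{-1}xy$. For a subgroup $H$ of $G$: $Z(H,G) = \{x \in H : xy = yx \text{ for all } y \in G\}$ and $K(H,G) = \{[x,y] : x \in H,\ y \in G\}$. $C_H(x) = \{y \in H : xy = yx\}$. The relative $g$-noncommuting graph $\Gamma_{H,G}^g$ is the simple undirected graph with vertex set $G$ in which two distinct vertices $x,y$ are adjacent if and only if ($x \in H$ or $y \in H$) and $[x,y] \neq g$ and $[x,y] \neq g^{-1}$. *)

(* Defs.v *)
From mathcomp Require Import all_boot all_order all_algebra all_fingroup.

Set Implicit Arguments.
Unset Strict Implicit.
Unset Printing Implicit Defensive.

Import GroupScope.

(* The commutator [~ x, y] = x^-1 * x ^ y is x^-1 y^-1 x y. Library notions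
   to be used as such: Z(H, G) is 'C_H(G), K(H, G) is commg_set H G, C_H(x) is
   'C_H[x], and x is H-conjugate to z when z \in x ^: H = {h^-1 x h | h in H}. *)

(* The graph has vertex set G; it is encoded as a relation on the ambient
   type that is false outside G. *)
Definition gnc_adj (gT : finGroupType) (G H : {set gT}) (g : gT) : rel gT :=
  fun x y =>
    [&& x \in G, y \in G, x != y, (x \in H) || (y \in H),
        [~ x, y] != g & [~ x, y] != g^-1].

Definition gnc_deg (gT : finGroupType) (G H : {set gT}) (g x : gT) : nat :=
  #|[set y in G | gnc_adj G H g x y]|.

Lemma gnc_adj_irr (gT : finGroupType) (G H : {set gT}) (g : gT) :
  irreflexive (gnc_adj G H g).
Proof. by move=> x; rewrite /gnc_adj eqxx !andbF. Qed.

Lemma gnc_adj_sym (gT : finGroupType) (G H : {set gT}) (g : gT) :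
  symmetric (gnc_adj G H g).
Proof.
move=> x y; rewrite /gnc_adj -(invg_comm x y) (inj_eq invg_inj) eqg_invLR.
rewrite (eq_sym y x) (orbC (y \in H)).
by do !case: (_ \in _) => //=; case: (x != y) => //=; rewrite andbC.
Qed.

(* Main.v *)
Require Import Defs.
From mathcomp Require Import all_boot all_order all_algebra all_fingroup.

Set Implicit Arguments.
Unset Strict Implicit.
Unset Printing Implicit Defensive.

Import GroupScope.

(** A vertex x outside H is adjacent only to elements of H, so its degree is
    |H| minus the number of y in H with [~ x, y] = g or [~ x, y] = g^-1.
    Since [~ x, y] = z amounts to x ^ y = x * z, the y in H with
    [~ x, y] = z are the elements of H that conjugate x to x * z: they form
    a coset of 'C_H[x] if x * z is H-conjugate to x, and there are none
    otherwise ([card_comm_fiber]). The fibers over g and g^-1 coincide when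
    g is its own inverse, which covers g = 1 as well as the involutions, and
    are disjoint otherwise ([gnc_deg_involutive], [gnc_deg_noninvolutive]);
    the theorem only evaluates the resulting counts. *)

Definition comm_fiber (gT : finGroupType) (H : {set gT}) (x z : gT) :=
  [set y in H | [~ x, y] == z].

(** If h in H takes x to x * z, then y takes x to x * z exactly when y * h^-1
    fixes x, so that the fiber is the coset of 'C_H[x] through h. *)
Lemma card_comm_fiber (gT : finGroupType) (H : {group gT}) (x z : gT) :
  #|comm_fiber H x z| = ((x * z \in x ^: H)%g * #|'C_H[x]|)%N.
Proof.
have fiberE y : ([~ x, y] == z) = (x ^ y == x * z).
  by rewrite commgEl -(inj_eq (mulgI x)) mulKVg.
case: (boolP (x * z \in x ^: H)) => [/imsetP[h hH xzE] | notconj].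
  rewrite mul1n -(card_rcoset 'C_H[x] h); apply: eq_card => y.
  rewrite inE fiberE xzE mem_rcoset in_setI groupMr ?groupV //.
  apply: andb_id2l => _; rewrite -(inj_eq (conjg_inj h^-1)) -!conjgM mulgV conjg1.
  by rewrite conjg_fix (sameP commgP cent1P) cent1C.
rewrite mul0n; apply: eq_card0 => y; rewrite inE fiberE.
apply/andP=> -[yH /eqP xyE]; case/negP: notconj.
by rewrite -xyE memJ_class.
Qed.

Lemma gnc_degD_fibers (gT : finGroupType) (G H : {group gT}) (g x : gT) :
  H \subset G -> x \in G :\: H ->
  (gnc_deg G H g x + #|comm_fiber H x g :|: comm_fiber H x g^-1|)%N = #|H|.
Proof.
move=> sHG /setDP[xG xH].
rewrite addnC -(cardsID (comm_fiber H x g :|: comm_fiber H x g^-1) H).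
congr (_ + _)%N; apply: eq_card => y; rewrite !inE; first by case: (y \in H).
rewrite /gnc_adj xG (negPf xH) /=; case yH: (y \in H); last by rewrite !andbF.
have ->: y \in G by apply: (subsetP sHG).
have -> /=: x != y by apply: contraNneq xH => ->.
by rewrite negb_or andbT.
Qed.

Lemma gnc_deg_involutive (gT : finGroupType) (G H : {group gT}) (g x : gT) :
  H \subset G -> x \in G :\: H -> g^-1 = g ->
  (gnc_deg G H g x + (x * g \in x ^: H)%g * #|'C_H[x]|)%N = #|H|.
Proof. by move=> sHG xGH gV; rewrite -(gnc_degD_fibers g sHG xGH) gV setUid card_comm_fiber. Qed.

Lemma gnc_deg_noninvolutive (gT : finGroupType) (G H : {group gT}) (g x : gT) :
  H \subset G -> x \in G :\: H -> g^-1 != g ->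
  (gnc_deg G H g x
   + ((x * g \in x ^: H)%g + (x * g^-1 \in x ^: H)%g) * #|'C_H[x]|)%N = #|H|.
Proof.
move=> sHG xGH gV; rewrite -(gnc_degD_fibers g sHG xGH) mulnDl -!card_comm_fiber cardsU.
suff -> : comm_fiber H x g :&: comm_fiber H x g^-1 = set0.
  by rewrite cards0 subn0.
apply/setP=> y; rewrite !inE; apply/negP=> /andP[/andP[_ /eqP ->]].
by rewrite eq_sym (negPf gV) andbF.
Qed.

Theorem theorem2p2 (gT : finGroupType) (G H : {group gT}) (g x : gT)
    (nabG : ~~ abelian G) (sHG : H \subset G)
    (neqZ : H :!=: 'C_H(G))
    (gK : g \in commg_set H G)
    (xGH : x \in G :\: H) :
  [/\ (* (a) *)
      g = 1 ->
        ((gnc_deg G H g x)%:Z = #|H|%:Z - #|'C_H[x]|%:Z)%R,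
      (* (b) *)
      g <> 1 -> g ^+ 2 <> 1 ->
        ((x * g \in x ^: H) (+) (x * g^-1 \in x ^: H) ->
           ((gnc_deg G H g x)%:Z = #|H|%:Z - #|'C_H[x]|%:Z)%R)
        /\
        ((x * g \in x ^: H) && (x * g^-1 \in x ^: H) ->
           ((gnc_deg G H g x)%:Z = #|H|%:Z - 2 * #|'C_H[x]|%:Z)%R)
    & (* (c) *)
      g <> 1 -> g ^+ 2 = 1 ->
        x * g \in x ^: H ->
        ((gnc_deg G H g x)%:Z = #|H|%:Z - #|'C_H[x]|%:Z)%R].
Proof.
have deg_eq k : (gnc_deg G H g x + k)%N = #|H| ->
    ((gnc_deg G H g x)%:Z = #|H|%:Z - k%:Z)%R.
  by move=> <-; rewrite PoszD GRing.addrK.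
split.
- move=> g1; apply: deg_eq; have gV : g^-1 = g by rewrite g1 invg1.
  by rewrite -{1}(gnc_deg_involutive sHG xGH gV) g1 mulg1 class_refl mul1n.
- move=> _ g2; have gV : g^-1 != g.
    by rewrite eq_invg_mul; apply/eqP.
  have degE := gnc_deg_noninvolutive sHG xGH gV.
  split=> [one | /andP[xg xgV]].
    by apply: deg_eq; move: degE one; do 2!case: (_ \in _); rewrite ?mul1n.
  by rewrite -PoszM; apply: deg_eq; move: degE; rewrite xg xgV.
move=> _ g2 xg; have gV : g^-1 = g by apply/eqP; rewrite eq_invg_mul -expg2 g2.
by apply: deg_eq; rewrite -{1}(gnc_deg_involutive sHG xGH gV) xg mul1n.
Qed.
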